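(* Let $\Omega=\bigcup_{n\in\mathbb N}A_n\ne\emptyset$, where $(A_n)_{n\in\mathbb N}$ is an increasing sequence of internal subsets of $\widetilde{\mathbb R}^d$ such that $A_{n+1}$ is a neighbourhood of $A_n$ (for the sharp topology), for each $n$. Let $u\in\widetilde{\mathcal G}(\Omega)$. The following are equivalent: (1) there exists $v\in\widetilde{\mathcal G}(\Omega)$ such that $uv=1$; (2) for each $\tilde x\in\Omega$, $u(\tilde x)$ is invertible in $\widetilde{\mathbb C}$; (3) for each $m\in\mathbb N$ (with $A_m\neq\emptyset$), $u_{|A_m}\in\widetilde{\mathcal G}(A_m)$ has a multiplicative inverse in $\widetilde{\mathcal G}(A_m)$.
   Context: Nets are indexed by $\varepsilon\in(0,1)$; ''for small $\varepsilon$'' means for all $\varepsilon\le\varepsilon_0$ for some $\varepsilon_0\in(0,1)$. For $E=\mathbb C$ or $E=\mathbb R^d$, a net $(x_\varepsilon)_\varepsilon$ in $E$ is moderate ($\in\mathcal M_E$) if there is $N\in\mathbb N$ with $|x_\varepsilon|\le\varepsilon^{-N}$ for small $\varepsilon$, and negligible ($\in\mathcal N_E$) if for each $m\in\mathbb N$, $|x_\varepsilon|\le\varepsilon^m$ for small $\varepsilon$. $\widetilde{\mathbb C}=\mathcal M_{\mathbb C}/\mathcal N_{\mathbb C}$, $\widetilde{\mathbb R}^d=\mathcal M_{\mathbb R^d}/\mathcal N_{\mathbb R^d}$; $[(x_\varepsilon)_\varepsilon]$ is the class of $(x_\varepsilon)_\varepsilon$. For $\tilde x=[(x_\varepsilon)_\varepsilon]$,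 $\mathrm v(\tilde x)=\sup\{b\in\mathbb R:|x_\varepsilon|\le\varepsilon^b\text{ for small }\varepsilon\}$ and $|\tilde x|_{\mathrm e}=e^{-\mathrm v(\tilde x)}$ (sharp norm). The sharp topology on $\widetilde{\mathbb R}^d$ is the topology of the ultrametric $|\tilde x_1-\tilde x_2|_{\mathrm e}$; a neighbourhood of a set is a set that is a neighbourhood of each of its points. A subset of $\widetilde{\mathbb R}^d$ is internal if it is of the form $[(A_\varepsilon)_\varepsilon]:=\{\tilde x\in\widetilde{\mathbb R}^d:\tilde x\text{ has a representative }(x_\varepsilon)_\varepsilon\text{ with }x_\varepsilon\in A_\varepsilon\text{ for small }\varepsilon\}$ for some net of subsets $A_\varepsilon\subseteq\mathbb R^d$. For $\emptyset\ne A\subseteq\widetilde{\mathbb R}^d$, $\widetilde{\mathcal G}(A)=\mathcal E_M(A)/\mathcal N(A)$, where $\mathcal E_M(A)$ (resp. $\mathcal N(A)$) is the set of nets $(u_\varepsilon)_\varepsilon$ of $C^\infty$ functions $\mathbb R^d\to\mathbb C$ such that for every $\alpha\in\mathbb N^d$ and every representative $(x_\varepsilon)_\varepsilon$ of every element of $A$, $(\partial^\alpha u_\varepsilon(x_\varepsilon))_\varepsilon\in\mathcal M_{\mathbb C}$ (resp. $\in\mathcal N_{\mathbb C}$). Operations are $\varepsilon$-wise; for $\emptyset\ne A\subseteq B$, restriction $\widetilde{\mathcal G}(B)\to\widetilde{\mathcal G}(A)$ is induced by the identity on representatives; point values are $u(\tilde x)=[(u_\varepsilon(x_\varepsilon))_\varepsilon]\in\widetilde{\mathbb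 C}$ for $\tilde x=[(x_\varepsilon)_\varepsilon]\in A$ (well-defined). *)

(* Defs.v *)
From HB Require Import structures.
From mathcomp Require Import all_boot all_order all_algebra.
From mathcomp Require Import complex.
From mathcomp Require Import all_classical all_reals all_analysis.
From mathcomp Require Import ring_quotient generic_quotient.
From mathcomp Require Import ring lra.

Set Implicit Arguments.
Unset Strict Implicit.
Unset Printing Implicit Defensive.

Import Order.TTheory GRing.Theory Num.Theory.
Import numFieldNormedType.Exports.
Import Normc.

Local Open Scope classical_set_scope.
Local Open Scope ring_scope.
Local Open Scope quotient_scope.

Definition eps_index (R : realType) := {e : R | 0 < e < 1}.

Section Small.
Variable R : realType.
Implicit Types (e : eps_index R) (P Q : eps_index R -> Prop) (a b : eps_index R -> R).

(* The property P holds for small e. *)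
Definition small P := exists e0, forall e, val e <= val e0 -> P e.

Definition moderate a := exists N : nat, small (fun e => a e <= val e ^- N).

Definition negligible a := forall m : nat, small (fun e => a e <= val e ^+ m).

Lemma eps_gt0 e : 0 < val e. Proof. by case: e => e /= /andP[]. Qed.

Lemma eps_le1 e : val e <= 1. Proof. by case: e => e /= /andP[_ /ltW]. Qed.

Lemma half_eps_subproof : 0 < (2^-1 : R) < 1. Proof. by apply/andP; split; lra. Qed.
Definition half_eps : eps_index R := Sub 2^-1 half_eps_subproof.

Lemma smallW P : (forall e, P e) -> small P.
Proof. by move=> h; exists half_eps. Qed.

Lemma smallS P Q : (forall e, P e -> Q e) -> small P -> small Q.
Proof. by move=> h [e0 he]; exists e0 => e /he /h. Qed.

Lemma smallI P Q : small P -> small Q -> small (fun e => P e /\ Q e).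
Proof.
move=> [e0 h0] [e1 h1]; have [le01|/ltW le10] := leP (val e0) (val e1).
  by exists e0 => e le_e; split; [apply: h0|apply: h1; apply: le_trans le_e _].
by exists e1 => e le_e; split; [apply: h0; apply: le_trans le_e _|apply: h1].
Qed.

Lemma small_half : small (fun e => val e <= 2^-1).
Proof. by exists half_eps => e. Qed.

Lemma moderateS a b : (forall e, a e <= b e) -> moderate b -> moderate a.
Proof. by move=> h [N hN]; exists N; apply: smallS hN => e; apply: le_trans. Qed.

Lemma negligibleS a b : (forall e, a e <= b e) -> negligible b -> negligible a.
Proof. by move=> h hb m; apply: smallS (hb m) => e; apply: le_trans. Qed.

Lemma moderate1 : moderate (fun=> 1).
Proof. by exists 0; apply: smallW => e; rewrite expr0 invr1. Qed.

Lemma negligible0 : negligible (fun=> 0).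
Proof. by move=> m; apply: smallW => e; rewrite exprn_ge0 // ltW // eps_gt0. Qed.

Lemma negligible_moderate a : negligible a -> moderate a.
Proof.
by move=> /(_ 0) h; exists 0; apply: smallS h => e; rewrite !expr0 invr1.
Qed.

Lemma moderateD a b :
  moderate a -> moderate b -> moderate (fun e => a e + b e).
Proof.
move=> [N hN] [M hM]; exists (N + M).+1%N.
apply: smallS (smallI small_half (smallI hN hM)) => e [e2 [aN bM]].
have e0 := eps_gt0 e; have e1 := eps_le1 e.
have le_k k : (k <= N + M)%N -> val e ^- k <= val e ^- (N + M).
  by move=> ?; rewrite lef_pV2 ?posrE ?exprn_gt0 // ler_wiXn2l // ltW.
have {}aN : a e <= val e ^- (N + M) := le_trans aN (le_k _ (leq_addr _ _)).
have {}bM : b e <= val e ^- (N + M) := le_trans bM (le_k _ (leq_addl _ _)).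
apply: le_trans (lerD aN bM) _.
rewrite exprS invfM -[leLHS]mulr2n -[leLHS]mulr_natl ler_wpM2r //.
  by rewrite invr_ge0 exprn_ge0 // ltW.
by rewrite -[leLHS]invrK lef_pV2 ?posrE ?invr_gt0.
Qed.

Lemma negligibleD a b :
  negligible a -> negligible b -> negligible (fun e => a e + b e).
Proof.
move=> ha hb m; apply: smallS (smallI small_half (smallI (ha m.+1) (hb m.+1))).
move=> e [e2 [am bm]]; apply: le_trans (lerD am bm) _.
rewrite exprS -mulrDl ler_piMl ?exprn_ge0 ?(ltW (eps_gt0 e)) //.
by move: e2; set x := val e => e2; lra.
Qed.

Lemma moderateM a b : (forall e, 0 <= a e) -> (forall e, 0 <= b e) ->
  moderate a -> moderate b -> moderate (fun e => a e * b e).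
Proof.
move=> a0 b0 [N hN] [M hM]; exists (N + M).
apply: smallS (smallI hN hM) => e [aN bM].
by rewrite exprD invfM ler_pM.
Qed.

Lemma negligibleM a b : (forall e, 0 <= a e) -> (forall e, 0 <= b e) ->
  moderate a -> negligible b -> negligible (fun e => a e * b e).
Proof.
move=> a0 b0 [N hN] hb m; apply: smallS (smallI hN (hb (N + m))) => e [aN bM].
apply: le_trans (ler_pM (a0 e) (b0 e) aN bM) _.
by rewrite exprD mulKf // expf_neq0 // gt_eqF ?eps_gt0.
Qed.

End Small.

Section Norms.
Variable R : realType.

Lemma normc_ge0 (z : R[i]) : 0 <= (normc z : R).
Proof. by case: z => a b; apply: sqrtr_ge0. Qed.

Lemma ler_normcD (z w : R[i]) : (normc (z + w) : R) <= normc z + normc w.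
Proof. exact: le_normcD. Qed.

Lemma normc_opp (z : R[i]) : normc (- z) = normc z :> R.
Proof. exact: normcN. Qed.

Definition enorm d (x : 'rV[R]_d) : R := Num.sqrt (\sum_(i < d) x 0 i ^+ 2).

Lemma enorm_ge0 d (x : 'rV[R]_d) : 0 <= enorm x.
Proof. exact: sqrtr_ge0. Qed.

Lemma enorm0 d : enorm (0 : 'rV[R]_d) = 0.
Proof. by rewrite /enorm big1 ?sqrtr0 // => i _; rewrite mxE expr0n. Qed.

Lemma enormN d (x : 'rV[R]_d) : enorm (- x) = enorm x.
Proof. by congr Num.sqrt; apply: eq_bigr => i _; rewrite mxE sqrrN. Qed.

(* A quasi-triangle inequality is enough to work with moderate nets. *)
Lemma enormD d (x y : 'rV[R]_d) :
  enorm (x + y) <= (enorm x + enorm y) + (enorm x + enorm y).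
Proof.
have [x0 y0] := (enorm_ge0 x, enorm_ge0 y).
rewrite -(@ler_pXn2r _ 2) ?nnegrE ?enorm_ge0 ?addr_ge0 //.
rewrite [leLHS]sqr_sqrtr; last by apply: sumr_ge0 => i _; apply: sqr_ge0.
apply: (@le_trans _ _ (2 * enorm x ^+ 2 + 2 * enorm y ^+ 2)); last first.
  move: (enorm x) (enorm y) x0 y0 => a b a0 b0.
  by have := mulr_ge0 a0 b0; have := sqr_ge0 a; have := sqr_ge0 b; nra.
rewrite !sqr_sqrtr; try by apply: sumr_ge0 => i _; apply: sqr_ge0.
rewrite !mulr_sumr -big_split /=; apply: ler_sum => i _; rewrite mxE.
by move: (x 0 i) (y 0 i) => a b; have := sqr_ge0 (a - b); nra.
Qed.

End Norms.

(* The quotient of a commutative ring by an ideal that need not be proper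
   (ring_quotient.v only covers proper ideals). *)
Section IdealQuotient.
Variables (T : comPzRingType) (I : zmodClosed T).
Hypothesis idealM : forall a u, u \in I -> a * u \in I.

Definition ideal_quotient of (forall a u, u \in I -> a * u \in I) : Type :=
  Quotient.quot I.
Local Notation Q := (ideal_quotient idealM).

HB.instance Definition _ := Choice.copy Q (Quotient.quot I).
HB.instance Definition _ := EqQuotient.copy Q (Quotient.quot I).
HB.instance Definition _ := GRing.Zmodule.copy Q (Quotient.quot I).

Definition quotient_one : Q := \pi_Q 1.
Definition quotient_mul := lift_op2 Q *%R.

Lemma quotient_eqP (x y : T) : reflect (\pi_Q x = \pi_Q y) (x - y \in I).
Proof.
have h := Quotient.idealrBE I x y.
by apply: (iffP idP) => [|/eqP]; [rewrite h => /eqP|rewrite h].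
Qed.

Lemma quotient_piM : {morph \pi_Q : x y / x * y >-> quotient_mul x y}.
Proof.
move=> x y; unlock quotient_mul; apply/quotient_eqP.
have hI (z : T) : z - repr (\pi_Q z) \in I by apply/quotient_eqP; rewrite reprK.
have -> : x * y - repr (\pi_Q x) * repr (\pi_Q y) =
    x * (y - repr (\pi_Q y)) + repr (\pi_Q y) * (x - repr (\pi_Q x)) by ring.
by rewrite rpredD ?idealM.
Qed.

Lemma quotient_piD : {morph \pi_Q : x y / x + y}.
Proof. exact: (@Quotient.pi_add T I). Qed.

Fact quotient_mulA : associative quotient_mul.
Proof.
move=> x y z; rewrite -[x]reprK -[y]reprK -[z]reprK.
by rewrite -!quotient_piM mulrA.
Qed.

Fact quotient_mulC : commutative quotient_mul.
Proof.
by move=> x y; rewrite -[x]reprK -[y]reprK -!quotient_piM mulrC.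
Qed.

Fact quotient_mul1 : left_id quotient_one quotient_mul.
Proof. by move=> x; rewrite -[x]reprK -quotient_piM mul1r. Qed.

Fact quotient_mulD : left_distributive quotient_mul +%R.
Proof.
move=> x y z; rewrite -[x]reprK -[y]reprK -[z]reprK.
by rewrite -quotient_piD -!quotient_piM -quotient_piD mulrDl.
Qed.

HB.instance Definition _ := GRing.Zmodule_isComPzRing.Build Q
  quotient_mulA quotient_mulC quotient_mul1 quotient_mulD.
End IdealQuotient.

Section GeneralizedNumbers.
Variable R : realType.

Definition moderate_C : {pred eps_index R -> R[i]} :=
  fun x => `[< moderate (fun e => normc (x e)) >].

Fact moderate_C_subring : subring_closed moderate_C.
Proof.
split=> [|x y /asboolP xM /asboolP yM|x y /asboolP xM /asboolP yM];
  apply/asboolP.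
- by apply: moderateS (moderate1 R) => e; rewrite normc1.
- apply: moderateS (moderateD xM yM) => e.
  by rewrite -[in leRHS](normc_opp (y e)) ler_normcD.
- apply: moderateS (moderateM _ _ xM yM) => e; rewrite ?normc_ge0 //.
  by rewrite [leLHS]normcM.
Qed.
HB.instance Definition _ := GRing.isSubringClosed.Build _ moderate_C
  moderate_C_subring.

Record modC := ModC { modC_val :> eps_index R -> R[i]; _ : modC_val \in moderate_C }.
HB.instance Definition _ := [isSub for modC_val].
HB.instance Definition _ := [Choice of modC by <:].
HB.instance Definition _ := GRing.SubChoice_isSubComPzRing.Build _ moderate_C modC (subringClosedP _).

Definition negligible_C : {pred eps_index R -> R[i]} :=
  fun x => `[< negligible (fun e => normc (x e)) >].

Fact negligible_C_zmod : zmod_closed negligible_C.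
Proof.
split=> [|x y /asboolP xN /asboolP yN]; apply/asboolP.
  by apply: negligibleS (negligible0 R) => e; rewrite normc0.
apply: negligibleS (negligibleD xN yN) => e.
by rewrite -[in leRHS](normc_opp (y e)) ler_normcD.
Qed.
HB.instance Definition _ := GRing.isZmodClosed.Build _ negligible_C
  negligible_C_zmod.

Lemma negligible_CM (a u : eps_index R -> R[i]) :
  a \in moderate_C -> u \in negligible_C -> a * u \in negligible_C.
Proof.
move=> /asboolP aM /asboolP uN; apply/asboolP.
apply: negligibleS (negligibleM _ _ aM uN) => e; rewrite ?normc_ge0 //.
by rewrite [leLHS]normcM.
Qed.

Definition null_C : {pred modC} := [preim modC_val of negligible_C].

Fact null_C_zmod : zmod_closed null_C.
Proof.
by split; [exact: negligible_C_zmod.1|move=> x y; exact: negligible_C_zmod.2].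
Qed.
HB.instance Definition _ := GRing.isZmodClosed.Build _ null_C null_C_zmod.

Fact null_C_ideal (a u : modC) : u \in null_C -> a * u \in null_C.
Proof. by move=> uN; exact: (negligible_CM (valP a) uN). Qed.

Definition Ctilde := ideal_quotient null_C_ideal.
HB.instance Definition _ := GRing.ComPzRing.on Ctilde.
HB.instance Definition _ := EqQuotient.on Ctilde.

Variable d : nat.

Definition moderate_R : {pred eps_index R -> 'rV[R]_d} :=
  fun x => `[< moderate (fun e => enorm (x e)) >].

Fact moderate_R_zmod : zmod_closed moderate_R.
Proof.
split=> [|x y /asboolP xM /asboolP yM]; apply/asboolP.
  by apply: moderateS (negligible_moderate (negligible0 R)) => e; rewrite enorm0.
have xyM := moderateD xM yM.
apply: moderateS (moderateD xyM xyM) => e.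
by rewrite -[in leRHS](enormN (y e)) enormD.
Qed.
HB.instance Definition _ := GRing.isZmodClosed.Build _ moderate_R
  moderate_R_zmod.

Record modR := ModR { modR_val :> eps_index R -> 'rV[R]_d;
                      _ : modR_val \in moderate_R }.
HB.instance Definition _ := [isSub for modR_val].
HB.instance Definition _ := [Choice of modR by <:].
HB.instance Definition _ := [SubChoice_isSubZmodule of modR by <:].

Definition negligible_R : {pred eps_index R -> 'rV[R]_d} :=
  fun x => `[< negligible (fun e => enorm (x e)) >].

Fact negligible_R_zmod : zmod_closed negligible_R.
Proof.
split=> [|x y /asboolP xN /asboolP yN]; apply/asboolP.
  by apply: negligibleS (negligible0 R) => e; rewrite enorm0.
have xyN := negligibleD xN yN.
apply: negligibleS (negligibleD xyN xyN) => e.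
by rewrite -[in leRHS](enormN (y e)) enormD.
Qed.
HB.instance Definition _ := GRing.isZmodClosed.Build _ negligible_R
  negligible_R_zmod.

Definition null_R : {pred modR} := [preim modR_val of negligible_R].

Fact null_R_zmod : zmod_closed null_R.
Proof.
by split; [exact: negligible_R_zmod.1|move=> x y; exact: negligible_R_zmod.2].
Qed.
HB.instance Definition _ := GRing.isZmodClosed.Build _ null_R null_R_zmod.

Definition Rtilde := Quotient.quot null_R.
HB.instance Definition _ := GRing.Zmodule.on Rtilde.
HB.instance Definition _ := EqQuotient.on Rtilde.

(* Independent of the representative: see valuation_pi below. *)
Definition valuation (x : Rtilde) : \bar R :=
  ereal_sup [set b%:E | b in
    [set b : R | small (fun e => enorm (repr x e) <= val e `^ b)]].

Lemma small_pow (s : R) : 0 < s -> small (fun e : eps_index R => 4 * val e `^ s <= 1).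
Proof.
move=> s0; have t0 : 0 < 4^-1 `^ s^-1 :> R by rewrite powR_gt0.
have t1 : 4^-1 `^ s^-1 < 1 `^ s^-1 :> R.
  apply: gt0_ltr_powR; rewrite ?invr_gt0 ?nnegrE ?invr_ge0 //.
  by rewrite invf_lt1 ?ltr1n.
rewrite powR1 in t1.
have t01 : 0 < (4^-1 : R) `^ s^-1 < 1 by rewrite t0 t1.
exists (exist (fun e : R => is_true (0 < e < 1)) _ t01) => e /= le_e.
have : val e `^ s <= 4^-1.
  have -> : 4^-1 = (4^-1 `^ s^-1) `^ s :> R.
    by rewrite -powRrM mulVf ?gt_eqF // powRr1.
  by apply: ge0_ler_powR; rewrite ?nnegrE ?(ltW s0) ?powR_ge0 ?(ltW (eps_gt0 e)).
by move: (val e `^ s) => z; lra.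
Qed.

Lemma valuation_le_subproof (x y : modR) : x - y \in null_R ->
  (ereal_sup [set b%:E | b in
      [set b : R | small (fun e => (enorm (x e) <= val e `^ b)%R)]] <=
   ereal_sup [set b%:E | b in
      [set b : R | small (fun e => (enorm (y e) <= val e `^ b)%R)]])%E.
Proof.
move=> /asboolP xyN; apply: ge_ereal_sup => _ [b /= xb <-].
apply/lee_subgt0Pr => s s0; rewrite -EFinB; apply: ereal_sup_ubound.
exists (b - s) => //=.
have [m bm] : exists m : nat, b <= m%:R.
  exists (Num.truncn `|b|).+1; apply: le_trans (ler_norm b) _.
  by apply/ltW/truncnS_gt.
apply: smallS (smallI (small_pow s0) (smallI xb (xyN m))) => e [es [xe xye]].
have e0 := eps_gt0 e; have e1 := eps_le1 e.
have -> : y e = x e + - (x e - y e) by rewrite opprB addrC subrK.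
apply: le_trans (enormD _ _) _; rewrite enormN.
have em : val e ^+ m <= val e `^ b.
  by rewrite -powR_mulrn ?(ltW e0) //; apply: ger_powR; rewrite ?e0 ?e1.
have {}xye : enorm (x e - y e) <= val e `^ b := le_trans xye em.
have -> : val e `^ (b - s) = val e `^ b / val e `^ s.
  by apply: powRB; rewrite (gt_eqF e0) implybT.
rewrite ler_pdivlMr ?powR_gt0 //.
move: es xe xye (powR_gt0 s e0) (powR_gt0 b e0).
move: (enorm (x e)) (enorm (x e - y e)) (val e `^ b) (val e `^ s).
move=> p q B S S1 pB qB S0 B0; nra.
Qed.

Lemma valuation_pi (x : modR) :
  valuation (\pi_Rtilde x) = ereal_sup [set b%:E | b in
    [set b : R | small (fun e => enorm (x e) <= val e `^ b)]].
Proof.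
have xN : repr (\pi_Rtilde x) - x \in null_R.
  by rewrite Quotient.idealrBE; apply/eqP/reprK.
apply/eqP; rewrite eq_le !valuation_le_subproof //.
by rewrite -opprB rpredN.
Qed.

(* The valuation of a moderate net is never -oo, so that the exponential below
   is finite; it is 0 exactly when the valuation is +oo. *)
Definition sharp_norm (x : Rtilde) : R := fine (expeR (- valuation x)%E).

Definition sharp_ball (x : Rtilde) (r : R) : set Rtilde :=
  [set y | sharp_norm (y - x) < r].

(* Neighbourhoods for the topology of the ultrametric sharp_norm (y - x). *)
Definition sharp_nbhs (x : Rtilde) (B : set Rtilde) : Prop :=
  exists2 r : R, 0 < r & sharp_ball x r `<=` B.

Definition sharp_nbhs_of (A B : set Rtilde) : Prop :=
  forall x, A x -> sharp_nbhs x B.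

Definition internal_set (A : eps_index R -> set 'rV[R]_d) : set Rtilde :=
  [set x | exists y : modR, \pi_Rtilde y = x /\ small (fun e => A e (y e))].

Definition internal (B : set Rtilde) : Prop := exists A, B = internal_set A.

End GeneralizedNumbers.

Section Smooth.
Variables (R : realType) (d : nat).
Implicit Types (u v : 'rV[R]_d -> R[i]) (s t : seq 'I_d).

Definition re u : 'rV[R]_d -> R := fun x => complex.Re (u x).
Definition im u : 'rV[R]_d -> R := fun x => complex.Im (u x).

(* A C-valued map of real variables is differentiated componentwise. *)
Definition partial (i : 'I_d) u : 'rV[R]_d -> R[i] :=
  fun x => ('D_(delta_mx 0 i) (re u) x +i* 'D_(delta_mx 0 i) (im u) x)%C.

Definition partials s u := foldr partial u s.

Definition differentiates u : Prop := forall i x,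
  derivable (re u) x (delta_mx 0 i) /\ derivable (im u) x (delta_mx 0 i).

(* C^oo: the iterated partial derivatives of all orders, taken in any order,
   exist and are continuous on the whole space. *)
Definition smooth u : Prop := forall s,
  [/\ continuous (re (partials s u)), continuous (im (partials s u))
    & differentiates (partials s u)].

(* The multi-index a as the word 0...01...1...(d-1)...(d-1) in which i occurs
   a i times. *)
Definition multi_seq (a : {ffun 'I_d -> nat}) : seq 'I_d :=
  flatten [seq nseq (a i) i | i <- enum 'I_d].

Definition mpartial (a : {ffun 'I_d -> nat}) u := partials (multi_seq a) u.

(* Pointwise forms, much cheaper to unify than the library ones. *)
Lemma derivable_mul (f g : 'rV[R]_d -> R) x h : derivable f x h ->
  derivable g x h -> derivable (fun y => f y * g y) x h.
Proof. by move=> hf hg; exact: (derivableM hf hg). Qed.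

Lemma derive_mul (f g : 'rV[R]_d -> R) x h : derivable f x h ->
  derivable g x h ->
  'D_h (fun y => f y * g y) x = f x * 'D_h g x + g x * 'D_h f x.
Proof. by move=> hf hg; exact: (deriveM hf hg). Qed.

Lemma reB u v : re (u - v) = re u - re v.
Proof. by apply/funext => x; rewrite /re !fctE; case: (u x) (v x) => [? ?] []. Qed.

Lemma imB u v : im (u - v) = im u - im v.
Proof. by apply/funext => x; rewrite /im !fctE; case: (u x) (v x) => [? ?] []. Qed.

Lemma reD u v : re (u + v) = re u + re v.
Proof. by apply/funext => x; rewrite /re !fctE; case: (u x) (v x) => [? ?] []. Qed.

Lemma imD u v : im (u + v) = im u + im v.
Proof. by apply/funext => x; rewrite /im !fctE; case: (u x) (v x) => [? ?] []. Qed.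

Lemma reM u v : re (u * v) =
  (fun x => re u x * re v x) - (fun x => im u x * im v x).
Proof.
by apply/funext => x; rewrite /re /im !fctE; case: (u x) (v x) => [? ?] [].
Qed.

Lemma imM u v : im (u * v) =
  (fun x => re u x * im v x) + (fun x => im u x * re v x).
Proof.
by apply/funext => x; rewrite /re /im !fctE; case: (u x) (v x) => [? ?] [].
Qed.

Lemma differentiatesB u v :
  differentiates u -> differentiates v -> differentiates (u - v).
Proof.
move=> du dv i x; have [[? ?] [? ?]] := (du i x, dv i x).
by rewrite reB imB; split; apply: derivableB.
Qed.

Lemma differentiatesD u v :
  differentiates u -> differentiates v -> differentiates (u + v).
Proof.
move=> du dv i x; have [[? ?] [? ?]] := (du i x, dv i x).
by rewrite reD imD; split; apply: derivableD.
Qed.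

Lemma differentiatesM u v :
  differentiates u -> differentiates v -> differentiates (u * v).
Proof.
move=> du dv i x; have [[? ?] [? ?]] := (du i x, dv i x).
by rewrite reM imM; split; [apply: derivableB|apply: derivableD];
  apply: derivable_mul.
Qed.

Lemma differentiates_cst (c : R[i]) : differentiates (cst c).
Proof. by move=> i x; split; apply: derivable_cst. Qed.

Lemma partial_cst i (c : R[i]) : partial i (cst c) = cst 0.
Proof.
by apply/funext => x; rewrite /partial; congr Complex; apply: derive_cst.
Qed.

Lemma partialB i u v : differentiates u -> differentiates v ->
  partial i (u - v) = partial i u - partial i v.
Proof.
move=> du dv; apply/funext => x; have [[? ?] [? ?]] := (du i x, dv i x).
by rewrite /partial reB imB !deriveB.
Qed.

Lemma partialD i u v : differentiates u -> differentiates v ->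
  partial i (u + v) = partial i u + partial i v.
Proof.
move=> du dv; apply/funext => x; have [[? ?] [? ?]] := (du i x, dv i x).
by rewrite /partial reD imD !deriveD.
Qed.

Lemma partialM i u v : differentiates u -> differentiates v ->
  partial i (u * v) = partial i u * v + u * partial i v.
Proof.
move=> du dv; apply/funext => x; have [[? ?] [? ?]] := (du i x, dv i x).
rewrite /partial reM imM.
rewrite (deriveB (derivable_mul _ _) (derivable_mul _ _)) //.
rewrite (deriveD (derivable_mul _ _) (derivable_mul _ _)) //.
rewrite (@derive_mul (re u) (re v)) // (@derive_mul (im u) (im v)) //.
rewrite (@derive_mul (re u) (im v)) // (@derive_mul (im u) (re v)) //.
rewrite !fctE /re /im; case: (u x) (v x) => [a b] [a' b'] /=.
by apply/eqP; rewrite eq_complex /=; apply/andP; split; apply/eqP; ring.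
Qed.

Definition regular u : Prop :=
  [/\ continuous (re u), continuous (im u) & differentiates u].

Lemma regular_cst c : regular (cst c).
Proof.
split; last exact: differentiates_cst.
  exact: (@cst_continuous _ _ (complex.Re c)).
exact: (@cst_continuous _ _ (complex.Im c)).
Qed.

Lemma regularB u v : regular u -> regular v -> regular (u - v).
Proof.
move=> [ru iu du] [rv iv dv]; split; last exact: differentiatesB.
  by rewrite reB => x; exact: continuousB (ru x) (rv x).
by rewrite imB => x; exact: continuousB (iu x) (iv x).
Qed.

Lemma regularD u v : regular u -> regular v -> regular (u + v).
Proof.
move=> [ru iu du] [rv iv dv]; split; last exact: differentiatesD.
  by rewrite reD => x; exact: continuousD (ru x) (rv x).
by rewrite imD => x; exact: continuousD (iu x) (iv x).
Qed.

Lemma regularM u v : regular u -> regular v -> regular (u * v).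
Proof.
move=> [ru iu du] [rv iv dv]; split; last exact: differentiatesM.
  rewrite reM => x.
  exact: continuousB (continuousM (ru x) (rv x)) (continuousM (iu x) (iv x)).
rewrite imM => x.
exact: continuousD (continuousM (ru x) (iv x)) (continuousM (iu x) (rv x)).
Qed.

Lemma smooth_regular s u : smooth u -> regular (partials s u).
Proof. exact. Qed.

Lemma partials_cst s c : partials s (cst c) = cst (if s is [::] then c else 0).
Proof. by elim: s => //= i s ->; apply: partial_cst. Qed.

Lemma smooth_cst c : smooth (cst c).
Proof. by move=> s; rewrite partials_cst; apply: regular_cst. Qed.

Lemma partialsB s u v : smooth u -> smooth v ->
  partials s (u - v) = partials s u - partials s v.
Proof.
move=> su sv; elim: s => //= i s ->; apply: partialB.
  by have [] := su s.
by have [] := sv s.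
Qed.

Lemma smoothB u v : smooth u -> smooth v -> smooth (u - v).
Proof. by move=> su sv s; rewrite partialsB //; apply: regularB. Qed.

Fixpoint splits s : seq (seq 'I_d * seq 'I_d) :=
  if s is i :: s' then
    [seq (i :: p.1, p.2) | p <- splits s'] ++
    [seq (p.1, i :: p.2) | p <- splits s']
  else [:: ([::], [::])].

Lemma splits_subseq s p : p \in splits s -> subseq p.1 s && subseq p.2 s.
Proof.
elim: s p => [|i s IHs] p /=; first by rewrite inE => /eqP ->.
rewrite mem_cat => /orP[] /mapP[q /IHs /andP[q1 q2] ->]; apply/andP.
  by split; [rewrite /= eqxx|apply: subseq_trans q2 (subseq_cons _ _)].
by split; [apply: subseq_trans q1 (subseq_cons _ _)|rewrite /= eqxx].
Qed.

Lemma regular_sum (I : Type) (r : seq I) (F : I -> 'rV[R]_d -> R[i]) :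
  (forall j, regular (F j)) -> regular (\sum_(j <- r) F j).
Proof.
move=> hF; elim: r => [|j r IHr]; first by rewrite big_nil; apply: regular_cst.
by rewrite big_cons; exact: (regularD (hF j) IHr).
Qed.

Lemma partial_sum i (I : Type) (r : seq I) (F : I -> 'rV[R]_d -> R[i]) :
  (forall j, regular (F j)) ->
  partial i (\sum_(j <- r) F j) = \sum_(j <- r) partial i (F j).
Proof.
move=> hF; elim: r => [|j r IHr]; first by rewrite !big_nil; apply: partial_cst.
have [_ _ dF] := regular_sum r hF; have [_ _ dFj] := hF j.
by rewrite !big_cons (partialD i dFj dF) IHr.
Qed.

Lemma partialsM s u v : smooth u -> smooth v ->
  partials s (u * v) = \sum_(p <- splits s) partials p.1 u * partials p.2 v.
Proof.
move=> su sv; elim: s => [|i s IHs] /=; first by rewrite big_seq1.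
rewrite IHs big_cat /= !big_map -big_split /=.
rewrite partial_sum => [|p]; last exact: (regularM (su p.1) (sv p.2)).
apply: eq_bigr => p _; apply: partialM; first by have [] := su p.1.
by have [] := sv p.2.
Qed.

Lemma smoothM u v : smooth u -> smooth v -> smooth (u * v).
Proof.
move=> su sv s; rewrite partialsM //.
by apply: regular_sum => p; exact: (regularM (su p.1) (sv p.2)).
Qed.

Lemma multi_seq_pairwise a : pairwise (relpre val leq) (multi_seq a).
Proof.
rewrite /multi_seq; have : pairwise (relpre val leq) (enum 'I_d).
  by rewrite -pairwise_map val_enum_ord -(sorted_pairwise leq_trans) iota_sorted.
elim: (enum _) => //= i s IHs /andP[/allP le_i /IHs ps].
rewrite pairwise_cat ps andbT; apply/andP; split.
  apply/allrelP => j k; rewrite mem_nseq => /andP[_ /eqP ->].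
  case/flattenP => t /mapP[l ls ->]; rewrite mem_nseq => /andP[_ /eqP ->].
  exact: le_i.
elim: (a i) => //= n ->; rewrite andbT; apply/allP => j.
by rewrite mem_nseq => /andP[_ /eqP ->] /=.
Qed.

Lemma multi_seq_count a i : count_mem i (multi_seq a) = a i.
Proof.
rewrite /multi_seq count_flatten -map_comp sumnE big_map big_enum /=.
rewrite (bigD1 i) //= big1 ?addn0 => [|j ji]; first by rewrite count_nseq /= eqxx mul1n.
by rewrite count_nseq /= (negPf ji).
Qed.

Lemma subseq_multi_seq a s : subseq s (multi_seq a) -> exists b, s = multi_seq b.
Proof.
move=> /subseq_pairwise/(_ (multi_seq_pairwise a)) ps.
exists [ffun i => count_mem i s].
have tr : transitive (relpre (val : 'I_d -> nat) leq).
  by move=> ? ? ?; apply: leq_trans.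
apply: (@sorted_eq _ (relpre val leq)) => //.
- by move=> i j /anti_leq /val_inj.
- by rewrite sorted_pairwise.
- by rewrite sorted_pairwise // multi_seq_pairwise.
by apply/allP => i _ /=; rewrite multi_seq_count ffunE.
Qed.

End Smooth.

Section GeneralizedFunctions.
Variables (R : realType) (d : nat).
Implicit Types (u v : eps_index R -> 'rV[R]_d -> R[i]) (A B : set (Rtilde R d)).

Definition partial_values (s : seq 'I_d) u (x : modR R d) : eps_index R -> R[i] :=
  fun e => partials s (u e) (x e).

Definition mpartial_values (a : {ffun 'I_d -> nat}) u (x : modR R d) :
    eps_index R -> R[i] :=
  fun e => mpartial a (u e) (x e).

Definition moderate_on A : {pred eps_index R -> 'rV[R]_d -> R[i]} :=
  fun u => `[< (forall e, smooth (u e)) /\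
    forall a (x : modR R d), A (\pi_(Rtilde R d) x) ->
      mpartial_values a u x \in moderate_C (R := R) >].

Definition negligible_on A : {pred eps_index R -> 'rV[R]_d -> R[i]} :=
  fun u => `[< (forall e, smooth (u e)) /\
    forall a (x : modR R d), A (\pi_(Rtilde R d) x) ->
      mpartial_values a u x \in negligible_C (R := R) >].

Lemma mpartial_valuesB a u v x : (forall e, smooth (u e)) ->
  (forall e, smooth (v e)) ->
  mpartial_values a (u - v) x = mpartial_values a u x - mpartial_values a v x.
Proof.
by move=> su sv; apply/funext => e; rewrite /mpartial_values /mpartial partialsB.
Qed.

Lemma mpartial_valuesM a u v x : (forall e, smooth (u e)) ->
  (forall e, smooth (v e)) ->
  mpartial_values a (u * v) x = \sum_(p <- splits (multi_seq a))
    partial_values p.1 u x * partial_values p.2 v x.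
Proof.
move=> su sv; apply/funext => e.
by rewrite /mpartial_values /mpartial partialsM // !fct_sumE.
Qed.

Lemma mpartial_valuesM_ind (P Q : {pred eps_index R -> R[i]})
    (K : zmodClosed (eps_index R -> R[i])) a u v x :
  (forall f g, f \in P -> g \in Q -> f * g \in K) ->
  (forall e, smooth (u e)) -> (forall e, smooth (v e)) ->
  (forall b, mpartial_values b u x \in P) ->
  (forall b, mpartial_values b v x \in Q) ->
  mpartial_values a (u * v) x \in K.
Proof.
move=> PQK su sv uP vQ; rewrite mpartial_valuesM // big_seq rpred_sum // => p.
move=> /splits_subseq /andP[/subseq_multi_seq[b pb] /subseq_multi_seq[c pc]].
by apply: PQK; rewrite ?pb ?pc; [apply: uP|apply: vQ].
Qed.

Section OnSet.
Variable A : set (Rtilde R d).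

Fact moderate_on_subring : subring_closed (moderate_on A).
Proof.
split=> [|u v /asboolP[su hu] /asboolP[sv hv]|u v /asboolP[su hu] /asboolP[sv hv]];
  apply/asboolP; split.
- by move=> e; apply: smooth_cst.
- move=> a x _; rewrite (_ : mpartial_values a 1 x =
      cst (if multi_seq a is [::] then 1 else 0)).
    by case: (multi_seq a) => [|_ _]; [apply: rpred1|apply: rpred0].
  by apply/funext => e; rewrite /mpartial_values /mpartial partials_cst.
- by move=> e; apply: smoothB.
- by move=> a x Ax; rewrite mpartial_valuesB // rpredB ?hu ?hv.
- by move=> e; apply: smoothM.
move=> a x Ax; apply: (@mpartial_valuesM_ind (moderate_C (R := R))
  (moderate_C (R := R)) (moderate_C (R := R))) => //.
- by move=> f g; apply: rpredM.
- by move=> b; apply: hu.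
- by move=> b; apply: hv.
Qed.
HB.instance Definition _ := GRing.isSubringClosed.Build _ (moderate_on A)
  moderate_on_subring.

Fact negligible_on_zmod : zmod_closed (negligible_on A).
Proof.
split=> [|u v /asboolP[su hu] /asboolP[sv hv]]; apply/asboolP; split.
- by move=> e; apply: smooth_cst.
- move=> a x _; rewrite (_ : mpartial_values a 0 x = 0) ?rpred0 //.
  apply/funext => e; rewrite /mpartial_values /mpartial partials_cst.
  by case: (multi_seq a).
- by move=> e; apply: smoothB.
- by move=> a x Ax; rewrite mpartial_valuesB // rpredB ?hu ?hv.
Qed.
HB.instance Definition _ := GRing.isZmodClosed.Build _ (negligible_on A)
  negligible_on_zmod.

Lemma negligible_onM u v :
  u \in moderate_on A -> v \in negligible_on A -> u * v \in negligible_on A.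
Proof.
move=> /asboolP[su hu] /asboolP[sv hv]; apply/asboolP; split.
  by move=> e; apply: smoothM.
move=> a x Ax; apply: (@mpartial_valuesM_ind (moderate_C (R := R))
  (negligible_C (R := R)) (negligible_C (R := R))) => //.
- exact: negligible_CM.
- by move=> b; apply: hu.
- by move=> b; apply: hv.
Qed.

Record modG := ModG { modG_val :> eps_index R -> 'rV[R]_d -> R[i];
                      _ : modG_val \in moderate_on A }.
HB.instance Definition _ := [isSub for modG_val].
HB.instance Definition _ := [Choice of modG by <:].
HB.instance Definition _ := GRing.SubChoice_isSubComPzRing.Build _
  (moderate_on A) modG (subringClosedP _).

Definition null_G : {pred modG} := [preim modG_val of negligible_on A].

Fact null_G_zmod : zmod_closed null_G.
Proof.
by split; [exact: negligible_on_zmod.1|move=> x y; exact: negligible_on_zmod.2].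
Qed.
HB.instance Definition _ := GRing.isZmodClosed.Build _ null_G null_G_zmod.

Fact null_G_ideal (a u : modG) : u \in null_G -> a * u \in null_G.
Proof. by move=> uN; exact: (negligible_onM (valP a) uN). Qed.

(* When A is empty this is the zero ring. *)
Definition Gtilde := ideal_quotient null_G_ideal.
HB.instance Definition _ := GRing.ComPzRing.on Gtilde.
HB.instance Definition _ := EqQuotient.on Gtilde.

Definition net_value u (x : modR R d) : eps_index R -> R[i] := fun e => u e (x e).

Fact net_value_moderate (u : modG) (x : modR R d) :
  A (\pi_(Rtilde R d) x) -> net_value u x \in moderate_C (R := R).
Proof.
have m0 : multi_seq [ffun=> 0%N] = [::] :> seq 'I_d.
  by rewrite /multi_seq; elim: (enum _) => //= i s ->; rewrite ffunE.
move=> Ax; have /asboolP[_ /(_ [ffun=> 0%N] x Ax)] := valP u.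
by rewrite /mpartial_values /mpartial m0.
Qed.

(* The class of e |-> u e (x e), for chosen representatives of u and x. *)
Definition point_value (u : Gtilde) (x : Rtilde R d) (Ax : A x) : Ctilde R :=
  \pi_(Ctilde R) (ModC (@net_value_moderate (repr u) (repr x)
    (eq_ind_r A Ax (reprK x)))).

End OnSet.

Fact restriction_moderate A B (AB : A `<=` B) (u : modG B) :
  modG_val u \in moderate_on A.
Proof.
have /asboolP[su hu] := valP u; apply/asboolP; split=> // a x /AB.
exact: hu.
Qed.

Definition restriction A B (AB : A `<=` B) (u : Gtilde B) : Gtilde A :=
  \pi_(Gtilde A) (ModG (restriction_moderate AB (repr u))).

Lemma restriction_pi A B (AB : A `<=` B) (u : modG B) :
  restriction AB (\pi_(Gtilde B) u) =
  \pi_(Gtilde A) (ModG (restriction_moderate AB u)).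
Proof.
apply/(quotient_eqP (@null_G_ideal A)).
have /asboolP[sN hN] : repr (\pi_(Gtilde B) u) - u \in null_G (A := B).
  by apply/(quotient_eqP (@null_G_ideal B)); rewrite reprK.
by apply/asboolP; split=> // a x /AB; exact: hN.
Qed.

End GeneralizedFunctions.

(* Main.v *)
(* The equivalence of (1) and (2) holds over every set of generalized points. If
   all the values of u are invertible, put v = conj u / (|u|^2 + delta), where
   delta_eps > 0 is a negligible net of constants. The denominator never
   vanishes, so v_eps is smooth on the whole space. At each representative x_eps
   of a point, |u_eps (x_eps)| is bounded below by a power of eps, so that the
   inverse of the denominator is moderate there, and so are its derivatives, by
   Leibniz' rule. Finally u v - 1 = - delta / (|u|^2 + delta) is negligible.
   Condition (3) lies between (1) and (2). *)
From HB Require Import structures.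
From mathcomp Require Import all_boot all_order all_algebra.
From mathcomp Require Import complex.
From mathcomp Require Import all_classical all_reals all_analysis.
From mathcomp Require Import generic_quotient ring lra.
Require Import Defs.

Set Implicit Arguments.
Unset Strict Implicit.
Unset Printing Implicit Defensive.

Import Order.TTheory GRing.Theory Num.Theory numFieldNormedType.Exports.
Import Normc.

Local Open Scope classical_set_scope.
Local Open Scope ring_scope.

(** * Conjugates and reciprocals of smooth functions, and the mean value theorem on lines *)

Section Differentiation.
Variables (R : realType) (d : nat).
Implicit Types (u v g h : 'rV[R]_d -> R[i]) (s : seq 'I_d).

Lemma smooth_partial i u : smooth u -> smooth (partial i u).
Proof.
move=> su s.
by have := su (rcons s i); rewrite /partials foldr_rcons.
Qed.

Definition conjf u : 'rV[R]_d -> R[i] := fun x => (u x)^*%C.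

Lemma re_conjf u : re (conjf u) = re u.
Proof. by apply/funext => x; rewrite /re /conjf; case: (u x). Qed.

Lemma im_conjf u : im (conjf u) = - im u.
Proof. by apply/funext => x; rewrite /im /conjf !fctE; case: (u x). Qed.

Lemma partials_conjf s u : smooth u ->
  partials s (conjf u) = conjf (partials s u).
Proof.
move=> su; elim: s => //= i s ->; apply/funext => x.
have [_ _ /(_ i x)[du dv]] := su s.
by rewrite /partial re_conjf im_conjf deriveN.
Qed.

Lemma smooth_conjf u : smooth u -> smooth (conjf u).
Proof.
move=> su s; have [ru iu du] := su s.
rewrite (partials_conjf s su) re_conjf im_conjf.
split; [exact: ru|by move=> x; exact: (continuousN (iu x))|move=> i x].
have [dr di] := du i x; rewrite re_conjf im_conjf.
by split; [exact: dr|exact: (derivableN di)].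
Qed.

Lemma re_inv g : re (fun x => (g x)^-1) =
  (fun x => re g x * (re g x * re g x + im g x * im g x)^-1).
Proof.
by apply/funext => x; rewrite /re /im; case: (g x) => a b /=; rewrite -!expr2.
Qed.

Lemma im_inv g : im (fun x => (g x)^-1) =
  (fun x => - im g x * (re g x * re g x + im g x * im g x)^-1).
Proof.
apply/funext => x; rewrite /re /im; case: (g x) => a b /=.
by rewrite -!expr2 mulNr.
Qed.

(** The real and imaginary parts of [1 / g] are quotients by [|g|^2], a real function without zeros,
    so the real rules for products and inverses apply. *)
Lemma regular_inv g : (forall x, g x != 0) -> regular g ->
  regular (fun x => (g x)^-1).
Proof.
move=> g0 [rg ig dg].
pose n x := re g x * re g x + im g x * im g x.
have n0 x : n x != 0.
  rewrite /n /re /im; move: (g0 x); case: (g x) => a b; apply: contra => /=.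
  by rewrite -!expr2 paddr_eq0 ?sqr_ge0 // !sqrf_eq0 eq_complex.
have cn : continuous n.
  move=> x.
  exact: continuousD (continuousM (rg x) (rg x)) (continuousM (ig x) (ig x)).
have cV : continuous (fun x => (n x)^-1).
  by move=> x; apply: continuousV => //; apply: cn.
have dV i x : derivable (fun x => (n x)^-1) x (delta_mx 0 i).
  have [dr di] := dg i x.
  exact: (derivableV (n0 x)
    (derivableD (derivable_mul dr dr) (derivable_mul di di))).
split.
- by rewrite re_inv => x; exact: continuousM (rg x) (cV x).
- rewrite im_inv => x.
  exact: continuousM (continuousN (ig x)) (cV x).
move=> i x; have [dr di] := dg i x; rewrite re_inv im_inv.
split; first exact: (derivable_mul dr (dV i x)).
exact: (derivable_mul (derivableN di) (dV i x)).
Qed.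

(** Once [1 / g] is known to be differentiable, differentiate [g * (1 / g) = 1] and multiply the
    result by [1 / g]. *)
Lemma partial_inv i g : (forall x, g x != 0) -> regular g ->
  partial i (fun x => (g x)^-1) =
  cst (-1) * (partial i g * ((fun x => (g x)^-1) * (fun x => (g x)^-1))).
Proof.
move=> g0 rg; set h := fun x => (g x)^-1.
have [_ _ dg] := rg; have [_ _ dh] := regular_inv g0 rg.
have gh : g * h = cst 1 by apply/funext => x; rewrite fctE divff.
have := partialM i dg dh; rewrite gh partial_cst => /esym E.
apply/funext => x; have := congr1 (fun f => f x * h x) E; rewrite !fctE.
rewrite mul0r mulrDl -[g x * _ * _]mulrAC /h divff // mul1r mulN1r.
by rewrite addrC mulrA => /eqP; rewrite addr_eq0 => /eqP.
Qed.

Inductive smooth_algebra h : ('rV[R]_d -> R[i]) -> Prop :=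
| Sa_smooth f of smooth f : smooth_algebra h f
| Sa_gen : smooth_algebra h h
| Sa_add f f' of smooth_algebra h f & smooth_algebra h f' :
    smooth_algebra h (f + f')
| Sa_mul f f' of smooth_algebra h f & smooth_algebra h f' :
    smooth_algebra h (f * f').

(* The algebra generated by 1 / g over the smooth functions consists of regular
   functions and is stable under differentiation. *)
Lemma smooth_inv g : (forall x, g x != 0) -> smooth g ->
  smooth (fun x => (g x)^-1).
Proof.
move=> g0 sg; set h := fun x => (g x)^-1.
have rg := sg [::].
have closed f : smooth_algebra h f ->
    regular f /\ forall i, smooth_algebra h (partial i f).
  elim=> {f} [f sf||f f' _ [rf pf] _ [rf' pf']|f f' Af [rf pf] Af' [rf' pf']].
  - by split; [exact: (sf [::])|move=> i; apply/Sa_smooth/smooth_partial].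
  - split; [exact: regular_inv|move=> i; rewrite partial_inv //].
    apply: Sa_mul; first exact/Sa_smooth/smooth_cst.
    apply: Sa_mul; first exact/Sa_smooth/smooth_partial.
    by apply: Sa_mul; apply: Sa_gen.
  - split; [exact: regularD|move=> i]; have [[_ _ ?] [_ _ ?]] := (rf, rf').
    by rewrite partialD //; apply: Sa_add.
  split; [exact: regularM|move=> i]; have [[_ _ ?] [_ _ ?]] := (rf, rf').
  by rewrite partialM //; apply: Sa_add; apply: Sa_mul.
move=> s; suff /closed[] : smooth_algebra h (partials s h) by [].
by elim: s => [|i s /closed[_ IHs]] /=; [apply: Sa_gen|apply: IHs].
Qed.

(** This isolates the term of Leibniz' rule in which every derivative falls on the first factor. All
    other terms differentiate that factor fewer times, which allows induction on the order. *)
Lemma splits_head s : exists2 r, splits s = (s, [::]) :: r &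
  forall p, p \in r -> (size p.1 < size s)%N.
Proof.
elim: s => [|i s [r E hr]] /=; first by exists [::].
rewrite E /=; eexists; first by [].
move=> p; rewrite mem_cat inE => /orP[/mapP[q /hr ? ->] //|/orP[/eqP -> //|]].
by case/mapP => q /hr qs -> /=; apply: leq_trans qs _.
Qed.

(** The difference quotients on both sides coincide as functions of the increment. *)
Lemma derive_line (f : 'rV[R]_d -> R) x w t : derivable f (x + t *: w) w ->
  is_derive t 1 (fun r => f (x + r *: w)) ('D_w f (x + t *: w)).
Proof.
have E : (fun h : R => h^-1 *: (((fun r => f (x + r *: w)) \o shift t) (h *: 1)
     - f (x + t *: w))) =
  (fun h : R => h^-1 *: ((f \o shift (x + t *: w)) (h *: w) - f (x + t *: w))).
  apply/funext => h; congr (_ *: (f _ - _)).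
  by rewrite /= scalerDl [h *: 1]mulr1 addrCA.
by move=> df; apply: DeriveDef; rewrite /derivable /derive E.
Qed.

Lemma MVT_line (f : 'rV[R]_d -> R) w x t : (forall y, derivable f y w) ->
  exists2 c, `|c| <= `|t| & f (x + t *: w) - f x = 'D_w f (x + c *: w) * t.
Proof.
move=> df; have MVTp y r : 0 <= r ->
    exists2 c, 0 <= c <= r & f (y + r *: w) - f y = 'D_w f (y + c *: w) * r.
  move=> r0; have [q _|//|c] := MVT_segment r0 (f := fun q => f (y + q *: w))
    (df := fun q => 'D_w f (y + q *: w)).
  - exact: derive_line.
  - apply: derivable_within_continuous => q _.
    by have [] := derive_line (df (y + q *: w)).
  by rewrite in_itv /= scale0r addr0 subr0 => c0r E; exists c.
have [t0|/ltW t0] := leP 0 t.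
  have [c /andP[c0 ct] E] := MVTp x t t0.
  by exists c => //; rewrite !ger0_norm.
(* For negative [t] the segment is traversed from its other end, so that its length [- t] is
   nonnegative. *)
have [|c /andP[c0 ct] E] := MVTp (x + t *: w) (- t); first by rewrite oppr_ge0.
exists (t + c); first by rewrite !ler0_norm //; move: c0 ct; lra.
move: E; rewrite scaleNr addrK mulrN => /(congr1 -%R).
by rewrite opprB opprK scalerDl addrA.
Qed.

End Differentiation.

(** * A positive negligible net, norm estimates, and changes of representative *)

Section Nets.
Variable R : realType.

Lemma moderate_small (a b : eps_index R -> R) :
  small (fun e => a e <= b e) -> moderate b -> moderate a.
Proof.
move=> ab [N bN]; exists N; apply: smallS (smallI ab bN) => e [] .
exact: le_trans.
Qed.

(** The exponent is unbounded as [e] tends to 0, so this net is eventually below every fixed power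
    of [e] while staying positive. *)
Definition tiny (e : eps_index R) : R := val e ^+ Num.truncn (val e)^-1.

Lemma tiny_gt0 e : 0 < tiny e.
Proof. by rewrite exprn_gt0 ?eps_gt0. Qed.

Lemma negligible_tiny : negligible tiny.
Proof.
(* Below this threshold the exponent in [tiny] is at least [m]. The shift by 2 keeps the threshold
   strictly below 1 even for [m = 0]. *)
move=> m; have m01 : 0 < (m.+2%:R : R)^-1 < 1.
  by rewrite invr_gt0 ltr0n invf_lt1 ?ltr0n // ltr1n.
exists (exist (fun r : R => is_true (0 < r < 1)) _ m01) => e /= em.
have e0 := eps_gt0 e; have e1 := eps_le1 e.
apply: ler_wiXn2l => //; first exact: ltW.
rewrite truncn_ge_nat ?invr_ge0 ?(ltW e0) //.
apply: (@le_trans _ _ m.+2%:R); first by rewrite ler_nat !leqW.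
by rewrite -[leLHS]invrK lef_pV2 ?posrE ?invr_gt0 ?ltr0n.
Qed.

Lemma normc_conjc (z : R[i]) : normc (z^*)%C = normc z.
Proof. by case: z => a b /=; rewrite sqrrN. Qed.

Lemma normc_real (r : R) : normc r%:C%C = `|r|.
Proof. by rewrite /= expr0n addr0 sqrtr_sqr. Qed.

Lemma normc_le_ReIm (z : R[i]) : normc z <= `|complex.Re z| + `|complex.Im z|.
Proof.
case: z => a b /=; rewrite -(@ler_pXn2r _ 2) ?nnegrE ?sqrtr_ge0 ?addr_ge0 //.
rewrite sqr_sqrtr ?addr_ge0 ?sqr_ge0 // sqrrD !real_normK ?num_real //.
by rewrite addrAC lerDl mulrn_wge0 ?mulr_ge0.
Qed.

Lemma Re_le_normc (z : R[i]) : `|complex.Re z| <= normc z.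
Proof.
by case: z => a b /=; rewrite -sqrtr_sqr ler_wsqrtr // lerDl sqr_ge0.
Qed.

Lemma Im_le_normc (z : R[i]) : `|complex.Im z| <= normc z.
Proof.
by case: z => a b /=; rewrite -sqrtr_sqr ler_wsqrtr // lerDr sqr_ge0.
Qed.

Lemma normc_sqrD (z : R[i]) (r : R) : 0 <= r ->
  normc (z * z^*%C + r%:C%C) = normc z ^+ 2 + r.
Proof.
move=> r0; have -> : z * z^*%C + r%:C%C = (normc z ^+ 2 + r)%:C%C.
  case: z => a b /=; rewrite sqr_sqrtr ?addr_ge0 ?sqr_ge0 //.
  by apply/eqP; rewrite eq_complex /=; apply/andP; split; apply/eqP; ring.
by rewrite normc_real ger0_norm // addr_ge0 // sqr_ge0.
Qed.

Lemma quotient_mul_eq1 (T : comPzRingType) (I : zmodClosed T)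
    (idealM : forall a u : T, u \in I -> a * u \in I) (x y : T) :
  (\pi_(ideal_quotient idealM)%qT x * \pi_(ideal_quotient idealM)%qT y = 1)
  <-> (x * y - 1 \in I).
Proof.
have -> : \pi_(ideal_quotient idealM)%qT x * \pi_(ideal_quotient idealM)%qT y =
   \pi_(ideal_quotient idealM)%qT (x * y) by rewrite quotient_piM.
by split=> /(quotient_eqP idealM).
Qed.

Variable d : nat.

Lemma coord_le_enorm (x : 'rV[R]_d) i : `|x 0 i| <= enorm x.
Proof.
rewrite -sqrtr_sqr ler_wsqrtr // (bigD1 i) //= lerDl.
by apply: sumr_ge0 => j _; apply: sqr_ge0.
Qed.

Lemma enorm_delta (t : R) (i : 'I_d) : enorm (t *: delta_mx 0 i) = `|t|.
Proof.
rewrite /enorm (bigD1 i) //= big1 ?addr0 => [|j ji].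
  by rewrite !mxE !eqxx mulr1 sqrtr_sqr.
by rewrite !mxE (negPf ji) andbF mulr0 expr0n.
Qed.

Lemma ler_enorm (x y : 'rV[R]_d) : (forall i, `|x 0 i| <= `|y 0 i|) ->
  enorm x <= enorm y.
Proof.
move=> xy; apply/ler_wsqrtr/ler_sum => i _.
rewrite -[leLHS]real_normK ?num_real // -[leRHS]real_normK ?num_real //.
by rewrite lerXn2r ?nnegrE.
Qed.

(** Moderateness on [A] is required at all representatives of a point, so it can be used at any net
    negligibly close to a given representative. *)
Lemma pi_modR (x : modR R d) (z : eps_index R -> 'rV[R]_d) :
  negligible (fun e => enorm (z e - x e)) ->
  exists2 y : modR R d, modR_val y = z &
    \pi_(Rtilde R d)%qT y = \pi_(Rtilde R d)%qT x.
Proof.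
move=> zx; have zM : z \in moderate_R (R := R) (d := d).
  rewrite -[z](subrK (modR_val x)); apply: rpredD; last exact: (valP x).
  exact/asboolP/negligible_moderate.
exists (ModR zM) => //; apply/eqP.
by rewrite -(Quotient.idealrBE (null_R (R := R) (d := d))); apply/asboolP.
Qed.

End Nets.

(** * Independence of point values from representatives, and moderateness of reciprocals *)

Section GeneralizedFunctions.
Variables (R : realType) (d : nat).
Implicit Types (A : set (Rtilde R d)) (u g : eps_index R -> 'rV[R]_d -> R[i]).

Lemma multi_seq1 (i : 'I_d) : multi_seq [ffun j => (j == i) : nat] = [:: i].
Proof.
apply: perm_small_eq => //; apply/allP => j _ /=.
by rewrite multi_seq_count ffunE addn0 [j == i]eq_sym.
Qed.

Lemma partial_moderate A u i (x : modR R d) : u \in moderate_on A ->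
  A (\pi_(Rtilde R d)%qT x) ->
  (fun e => partial i (u e) (x e)) \in moderate_C (R := R).
Proof.
move=> /asboolP[_ uM] Ax; have := uM [ffun j => (j == i) : nat] x Ax.
by rewrite /mpartial_values /mpartial multi_seq1.
Qed.

(** By the mean value theorem the increment is a partial derivative at an intermediate point times
    [t]. The intermediate points represent the same point of [A] as [x], so the derivative is
    moderate there, and its product with the negligible [t] is negligible. *)
Lemma net_value_coord A u i (x : modR R d) (t : eps_index R -> R) :
  u \in moderate_on A -> A (\pi_(Rtilde R d)%qT x) ->
  negligible (fun e => `|t e|) ->
  (fun e => u e (x e + t e *: delta_mx 0 i) - u e (x e))
    \in negligible_C (R := R).
Proof.
move=> uM Ax tN; have /asboolP[su _] := uM.
have along (f : eps_index R -> 'rV[R]_d -> R) :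
    (forall e y, derivable (f e) y (delta_mx 0 i)) ->
    exists2 z : modR R d, A (\pi_(Rtilde R d)%qT z) & forall e,
      f e (x e + t e *: delta_mx 0 i) - f e (x e) =
      'D_(delta_mx 0 i) (f e) (z e) * t e.
  move=> df; have /choice[c cP] : forall e, exists c, `|c| <= `|t e| /\
      f e (x e + t e *: delta_mx 0 i) - f e (x e) =
      'D_(delta_mx 0 i) (f e) (x e + c *: delta_mx 0 i) * t e.
    by move=> e; have [c ? ?] := MVT_line (x e) (t e) (df e); exists c.
  have [|z zE zx] := @pi_modR R d x (fun e => x e + c e *: delta_mx 0 i).
    apply: negligibleS tN => e; rewrite addrAC subrr add0r enorm_delta.
    by have [] := cP e.
  by exists z; rewrite ?zx // => e; rewrite zE; have [] := cP e.
(* The mean value theorem holds for real values only: the real and imaginary parts get separate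
   intermediate nets [z] and [z']. *)
have [|z Az Ez] := along (fun e => re (u e)).
  by move=> e y; have [_ _ /(_ i y)[dr _]] := su e [::]; exact: dr.
have [|z' Az' Ez'] := along (fun e => im (u e)).
  by move=> e y; have [_ _ /(_ i y)[_ di]] := su e [::]; exact: di.
have /asboolP zM := partial_moderate i uM Az.
have /asboolP z'M := partial_moderate i uM Az'.
have zN := negligibleM (fun e => normc_ge0 _) (fun e => normr_ge0 _) zM tN.
have z'N := negligibleM (fun e => normc_ge0 _) (fun e => normr_ge0 _) z'M tN.
apply/asboolP; apply: negligibleS (negligibleD zN z'N) => e.
have ReB (a b : R[i]) : complex.Re (a - b) = complex.Re a - complex.Re b.
  by case: a b => ? ? [].
have ImB (a b : R[i]) : complex.Im (a - b) = complex.Im a - complex.Im b.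
  by case: a b => ? ? [].
apply: le_trans (normc_le_ReIm _) _; rewrite ReB ImB.
apply: lerD.
  rewrite [X in `|X|]Ez normrM ler_wpM2r //.
  exact: Re_le_normc (partial i (u e) (z e)).
rewrite [X in `|X|]Ez' normrM ler_wpM2r //.
exact: Im_le_normc (partial i (u e) (z' e)).
Qed.

(* The representatives x and y are joined by a path changing one coordinate at
   a time. *)
Lemma net_value_wd A u (x y : modR R d) : u \in moderate_on A ->
  A (\pi_(Rtilde R d)%qT x) ->
  \pi_(Rtilde R d)%qT x = \pi_(Rtilde R d)%qT y ->
  net_value u y - net_value u x \in negligible_C (R := R).
Proof.
move=> uM Ax xy.
have yxN : negligible (fun e => enorm (y e - x e)).
  have /asboolP // : y - x \in null_R (R := R) (d := d).
  by rewrite Quotient.idealrBE xy.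
pose z k e := \row_j (if (j < k)%N then y e 0 j else x e 0 j).
have zS k (kd : (k < d)%N) e : z k.+1 e = z k e +
    (y e 0 (Ordinal kd) - x e 0 (Ordinal kd)) *: delta_mx 0 (Ordinal kd).
  apply/rowP => j; rewrite !mxE ltnS eqxx /=.
  have [->|jk] := eqVneq j (Ordinal kd).
    by rewrite /= leqnn ltnn mulr1 addrC subrK.
  rewrite mulr0 addr0 leq_eqVlt (_ : (j == k :> nat) = false) //.
  exact/negbTE.
have zN k : (k <= d)%N ->
    (fun e => u e (z k e) - u e (x e)) \in negligible_C (R := R).
  elim: k => [_|k IHk kd].
    rewrite (_ : (fun _ => _) = 0) ?rpred0 //; apply/funext => e.
    by rewrite (_ : z 0 e = x e) ?subrr //; apply/rowP => j; rewrite mxE.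
  (* Each coordinate of [z k e - x e] is 0 or that of [y e - x e], so the hybrid net [z k] still
     represents the class of [x]. *)
  have [|w wz wx] := @pi_modR R d x (z k).
    apply: negligibleS yxN => e; apply: ler_enorm => j; rewrite !mxE.
    by case: ifP => _ //; rewrite subrr normr0.
  have Aw : A (\pi_(Rtilde R d)%qT w) by rewrite wx.
  have := @net_value_coord A u (Ordinal kd) w
    (fun e => y e 0 (Ordinal kd) - x e 0 (Ordinal kd)) uM Aw.
  rewrite wz => step; rewrite (_ : (fun _ => _) =
    (fun e => u e (z k.+1 e) - u e (z k e)) +
    (fun e => u e (z k e) - u e (x e))).
    apply: rpredD; last exact: IHk (ltnW kd).
    rewrite (_ : (fun _ => _) = (fun e => u e (z k e +
      (y e 0 (Ordinal kd) - x e 0 (Ordinal kd)) *: delta_mx 0 (Ordinal kd))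
      - u e (z k e))); last by apply/funext => e; rewrite zS.
    apply: step; apply: negligibleS yxN => e.
    by have := coord_le_enorm (y e - x e) (Ordinal kd); rewrite !mxE.
  by apply/funext => e; rewrite !fctE addrA subrK.
rewrite (_ : _ - _ = fun e => u e (z d e) - u e (x e)); first exact: zN.
apply/funext => e.
rewrite /net_value !fctE; congr (u e _ - _).
by apply/rowP => j; rewrite mxE ltn_ord.
Qed.

Lemma moderate_on_conjf A u : u \in moderate_on A ->
  (fun e => conjf (u e)) \in moderate_on A.
Proof.
move=> /asboolP[su uM]; apply/asboolP; split.
  by move=> e; apply: smooth_conjf.
move=> a x Ax; apply/asboolP; have /asboolP := uM a x Ax.
apply: moderateS => e; rewrite /mpartial_values /mpartial partials_conjf //.
by rewrite normc_conjc.
Qed.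

Lemma negligible_on_cst A (c : eps_index R -> R[i]) :
  c \in negligible_C (R := R) -> (fun e => cst (c e)) \in negligible_on A.
Proof.
move=> cN; apply/asboolP; split=> [e|a x _]; first exact: smooth_cst.
rewrite (_ : mpartial_values _ _ _ = if multi_seq a is [::] then c else 0).
  by case: (multi_seq a) => // *; apply: rpred0.
apply/funext => e; rewrite /mpartial_values /mpartial partials_cst.
by case: (multi_seq a).
Qed.

(* Applying Leibniz' rule to (1 / g) * g = 1 expresses a derivative of 1 / g by
   derivatives of g and derivatives of 1 / g of lower order. *)
Lemma moderate_on_inv A g : g \in moderate_on A -> (forall e x, g e x != 0) ->
  (forall x : modR R d, A (\pi_(Rtilde R d)%qT x) ->
    net_value (fun e y => (g e y)^-1) x \in moderate_C (R := R)) ->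
  (fun e x => (g e x)^-1) \in moderate_on A.
Proof.
move=> /asboolP[sg gM] g0 hM; set h := fun e x => (g e x)^-1.
have sh e : smooth (h e) by apply: smooth_inv.
apply/asboolP; split=> // a x Ax.
have [n] := ubnP (size (multi_seq a)); elim: n a => // n IHn a an.
have [a0|a0] := eqVneq (multi_seq a) [::].
  by have := hM x Ax; rewrite /mpartial_values /mpartial a0.
have [r splE r_lt] := splits_head (multi_seq a).
have hg e : h e * g e = cst 1.
  by apply/funext => y; rewrite fctE mulVf.
rewrite (_ : mpartial_values a h x =
  - (\sum_(p <- r) partial_values p.1 h x * partial_values p.2 g x) *
    net_value h x).
  apply: rpredM (hM x Ax); rewrite rpredN big_seq rpred_sum // => p pr.
  have : p \in splits (multi_seq a) by rewrite splE inE pr orbT.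
  (* Both parts of a split are subwords of a sorted word, hence words of multi-indices [b] and [c],
     to which the induction hypothesis and [gM] apply. *)
  move=> /splits_subseq/andP[/subseq_multi_seq[b pb] /subseq_multi_seq[c pc]].
  apply: rpredM; last by rewrite pc; exact: gM.
  rewrite pb; apply: IHn; rewrite -pb; exact: leq_trans (r_lt p pr) an.
apply/funext => e; have := partialsM (multi_seq a) (sh e) (sg e).
rewrite hg partials_cst splE big_cons /=.
(* Since [multi_seq a] is not empty, the derivative of the constant 1 is 0. Multiplying by [h]
   cancels the factor [g] in the leading term. *)
move=> /(congr1 (fun f => f (x e) * h e (x e))).
rewrite !fctE !fct_sumE /mpartial_values /net_value /mpartial.
case: (multi_seq a) a0 => // i s _; rewrite mul0r mulrDl.
have -> q : q * g e (x e) * h e (x e) = q by rewrite mulfK.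
by move=> /esym/eqP; rewrite addr_eq0 mulNr => /eqP ->.
Qed.

End GeneralizedFunctions.

Lemma net_value_negligible (R : realType) (d : nat) (A : set (Rtilde R d))
    (u : eps_index R -> 'rV[R]_d -> R[i]) (x : modR R d) :
  u \in negligible_on A -> A (\pi_(Rtilde R d)%qT x) ->
  net_value u x \in negligible_C (R := R).
Proof.
have seq0 : multi_seq [ffun=> 0%N] = [::] :> seq 'I_d.
  by rewrite /multi_seq; elim: (enum _) => //= i s ->; rewrite ffunE.
move=> /asboolP[_ uN] /(uN [ffun=> 0%N]).
by rewrite /mpartial_values /mpartial seq0.
Qed.

(** * Invertibility of a generalized function and of its point values *)

Section Invertibility.
Variables (R : realType) (d : nat) (A : set (Rtilde R d)).
Implicit Types (u v : Gtilde A).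

Lemma point_value_invertible u v x (Ax : A x) : u * v = 1 ->
  exists w : Ctilde R, point_value u Ax * w = 1.
Proof.
rewrite -[u in u * _]reprK -[v]reprK => /quotient_mul_eq1 uvN.
have Ar : A (\pi_(Rtilde R d)%qT (repr x)) by rewrite reprK.
exists (\pi_(Ctilde R)%qT (ModC (net_value_moderate (repr v) Ar))).
exact/quotient_mul_eq1/(net_value_negligible uvN Ar).
Qed.

(** For small [e], [|f b - 1| <= e <= 1/2], hence [|f b| >= 1/2] and [|f|^2 >= 1 / (4 |b|^2)].
    Adding the positive [tiny e] only enlarges the denominator, so [|h| <= 4 |b|^2], which is
    moderate. *)
Lemma moderate_regularized_inverse (f b h : eps_index R -> R[i]) :
  b \in moderate_C (R := R) -> f * b - 1 \in negligible_C (R := R) ->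
  (forall e, normc (h e) = (normc (f e) ^+ 2 + tiny e)^-1) ->
  h \in moderate_C (R := R).
Proof.
move=> /asboolP bM /asboolP fbN hE.
have b2M := moderateM (fun e => normc_ge0 _) (fun e => normc_ge0 _) bM bM.
have b22M := moderateD b2M b2M.
apply/asboolP; apply: moderate_small (moderateD b22M b22M).
apply: smallS (smallI (small_half R) (fbN 1%N)) => e []; rewrite expr1 => e2 fb.
have {fb e2}fb : 2^-1 <= normc (f e) * normc (b e).
  have := ler_normcD (f e * b e) (- (f e * b e - 1)).
  rewrite normc_opp opprB addrC subrK normc1 normcM.
  move=> /le_trans/(_ (lerD (lexx _) (le_trans fb e2))).
  by move: (_ * _) => z; lra.
rewrite hE; move: fb (tiny_gt0 e) (normc_ge0 (f e)) (normc_ge0 (b e)).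
move: (tiny e) (normc (f e)) (normc (b e)) => t p q pq t0 p0 q0.
have p_gt0 : 0 < p.
  rewrite lt_neqAle p0 andbT; apply/eqP => p_0.
  by move: pq; rewrite -p_0 mul0r; lra.
rewrite -[leLHS]mul1r ler_pdivrMr ?addr_gt0 ?exprn_gt0 //.
have : 0 <= (q * q) * t by rewrite !mulr_ge0 // ltW.
have : 4^-1 <= (p * q) ^+ 2.
  by move: (p * q) pq => z z2; nra.
by nra.
Qed.

Lemma invertible_of_point_values u :
  (forall x (Ax : A x), exists w : Ctilde R, point_value u Ax * w = 1) ->
  exists v, u * v = 1.
Proof.
move=> uV; set U := repr u.
have UM : modG_val U \in moderate_on A := valP U.
have /asboolP[sU _] := UM.
pose cU e := conjf (U e); pose delta e := cst (tiny e)%:C%C : 'rV[R]_d -> R[i].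
have dN : delta \in negligible_on A.
  apply: negligible_on_cst; apply/asboolP.
  apply: negligibleS (@negligible_tiny R) => e.
  by rewrite normc_real gtr0_norm ?tiny_gt0.
have cM : cU \in moderate_on A := moderate_on_conjf UM.
pose g := modG_val U * cU + delta.
have gE e y : g e y = U e y * (U e y)^*%C + (tiny e)%:C%C by [].
have gn e y : normc (g e y) = normc (U e y) ^+ 2 + tiny e.
  by rewrite gE normc_sqrD // ltW ?tiny_gt0.
have g0 e y : g e y != 0.
  apply/eqP => gy; have := gn e y; rewrite gy normc0 => /esym/eqP.
  by rewrite gt_eqF // ltr_wpDl ?sqr_ge0 ?tiny_gt0.
have dM : delta \in moderate_on A.
  have /asboolP[sd hd] := dN; apply/asboolP; split=> // a x Ax.
  by have /asboolP/negligible_moderate ? := hd a x Ax; apply/asboolP.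
have gM : g \in moderate_on A by rewrite rpredD // rpredM.
pose h e y := (g e y)^-1.
have hM : h \in moderate_on A.
  apply: moderate_on_inv => // x Ax.
  have [w] := uV _ Ax; rewrite -[w]reprK => /quotient_mul_eq1.
  set b := repr w => bN.
  apply: (@moderate_regularized_inverse (net_value U x) b) => [||e].
  - exact: (valP b).
  (* The hypothesis inverts the value at the chosen representative [y], whereas moderateness is
     needed at an arbitrary [x] of the same class. The difference of the two values is negligible by
     [net_value_wd]. *)
  - set y := repr (\pi_(Rtilde R d)%qT x) in bN *.
    have yx : \pi_(Rtilde R d)%qT y = \pi_(Rtilde R d)%qT x := reprK _.
    have Ay : A (\pi_(Rtilde R d)%qT y) by rewrite yx.
    have xN := net_value_wd UM Ay yx.
    rewrite (_ : _ - 1 = (net_value U y * modC_val b - 1) +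
      modC_val b * (net_value U x - net_value U y)).
      by apply: rpredD; [exact: bN|exact: negligible_CM (valP b) xN].
    by apply/funext => e; rewrite !fctE; ring.
  by rewrite /net_value normcV gn.
exists (\pi_(Gtilde A)%qT (ModG (rpredM cM hM))).
rewrite -[u]reprK; apply/quotient_mul_eq1.
suff : modG_val U * (cU * h) - 1 \in negligible_on A by [].
rewrite (_ : _ - 1 = - (h * delta)); first by rewrite rpredN negligible_onM.
apply/funext => e; apply/funext => y; rewrite !fctE.
have -> : U e y * (cU e y * h e y) = (g e y - (tiny e)%:C%C) * h e y.
  by rewrite gE addrK mulrA.
by rewrite mulrBl /h divff // addrAC subrr add0r mulrC.
Qed.

Lemma restriction_mul_eq1 (B : set (Rtilde R d)) (BA : B `<=` A) u :
  (exists v, u * v = 1) -> exists v : Gtilde B, restriction BA u * v = 1.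
Proof.
move=> [v]; rewrite -[u in u * _]reprK -[v]reprK.
move=> /quotient_mul_eq1/asboolP[s uvN].
exists (\pi_(Gtilde B)%qT (ModG (restriction_moderate BA (repr v)))).
by apply/quotient_mul_eq1/asboolP; split=> // a x /BA; exact: uvN.
Qed.

(** The restriction is built from the same [repr u] as the point value, so the inverse on [B],
    evaluated at [repr x], gives the inverse of the value. *)
Lemma restriction_point_value_invertible (B : set (Rtilde R d)) (BA : B `<=` A)
    u (v : Gtilde B) x (Ax : A x) : B x -> restriction BA u * v = 1 ->
  exists w : Ctilde R, point_value u Ax * w = 1.
Proof.
move=> Bx; rewrite -[v]reprK => /quotient_mul_eq1 uvN.
have Br : B (\pi_(Rtilde R d)%qT (repr x)) by rewrite reprK.
exists (\pi_(Ctilde R)%qT (ModC (net_value_moderate (repr v) Br))).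
exact/quotient_mul_eq1/(net_value_negligible uvN Br).
Qed.

End Invertibility.

Theorem corollary3p20 (R : realType) (d : nat)
    (A : nat -> set (Rtilde R d))
    (A_internal : forall n, internal (A n))
    (A_incr : forall n, A n `<=` A n.+1)
    (A_nbhs : forall n, sharp_nbhs_of (A n) (A n.+1))
    (Omega0 : \bigcup_n A n !=set0)
    (u : Gtilde (\bigcup_n A n)) :
  [<-> exists v : Gtilde (\bigcup_n A n), u * v = 1;
       forall (x : Rtilde R d) (Ox : (\bigcup_n A n) x),
         exists w : Ctilde R, point_value u Ox * w = 1;
       forall m, A m !=set0 ->
         exists v : Gtilde (A m), restriction (bigcup_sup I) u * v = 1].
Proof.
tfae=> [[v uv] x Ox|uV m _|uV].
- exact: point_value_invertible uv.
(* (2) implies (3): a global inverse exists by (1) and is then restricted. *)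
- exact/restriction_mul_eq1/invertible_of_point_values.
(* (3) implies (1) by way of (2): every point of the union lies in some [A m], which is then
   nonempty. *)
apply: invertible_of_point_values => x Ox; have [m _ Ax] := Ox.
have [|v uv] := uV m; first by exists x.
exact: restriction_point_value_invertible Ax uv.
Qed.
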